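(* Assume in addition $J\in L^2(\mathbb{R}^N)$. Let $\beta$ be defined by $$\beta=\inf\Big\{\frac{\int_\Omega\int_\Omega J(x-y)(u(y)-u(x))^2\,dy\,dx}{\int_\Omega(u(x)-\langle u\rangle)^2\,dx}:\ u\in L^2(\Omega)\ \text{not a.e. constant}\Big\},$$ where $\langle u\rangle=|\Omega|^{-1}\int_\Omega u$; then $\beta>0$. For every $u_0\in L^2(\Omega)$ the solution $u$ of (N) with $g\equiv0$ and $u(\cdot,0)=u_0$ satisfies, for all $t\ge0$, $$\|u(\cdot,t)-\langle u_0\rangle\|_{L^2(\Omega)}^2\le e^{-\beta t}\|u_0-\langle u_0\rangle\|_{L^2(\Omega)}^2.$$
   Context: Standing assumptions: $\Omega\subset\mathbb{R}^N$ bounded, connected, smooth; $J\ge0$ symmetric, $\int J=1$, $J=0$ outside $B(0,d)$, $\inf_{B(0,\rho)}J>0$ for every $\rho<d$. Problem (N): $u_t(x,t)=\int_\Omega J(x-y)(u(y,t)-u(x,t))dy+\int_{\mathbb{R}^N\setminus\Omega}J(x-y)g(y,t)dy$ for $x\in\Omega$, $t>0$. *)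

(* Defs.v *)
From HB Require Import structures.
From mathcomp Require Import all_boot all_order all_algebra.
From mathcomp Require Import all_classical all_reals all_analysis.
Set Implicit Arguments. Unset Strict Implicit. Unset Printing Implicit Defensive.
Import Order.TTheory GRing.Theory Num.Theory.
Import numFieldNormedType.Exports.
Local Open Scope classical_set_scope.
Local Open Scope ring_scope.

Section measurable_rV.
Context (R : realType) (N : nat).
Let coord : 'I_N -> 'rV[R]_N -> R := fun i x => x ord0 i.
Let rV_set0 : g_sigma_preimage coord set0.
Proof. exact: sigma_algebra0. Qed.
Let rV_setC A : g_sigma_preimage coord A -> g_sigma_preimage coord (~` A).
Proof. exact: sigma_algebraC. Qed.
Let rV_bigcup (F : _^nat) : (forall i, g_sigma_preimage coord (F i)) ->
  g_sigma_preimage coord (\bigcup_i (F i)).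
Proof. exact: sigma_algebra_bigcup. Qed.
HB.instance Definition _ := @isMeasurable.Build default_measure_display
  'rV[R]_N (g_sigma_preimage coord) rV_set0 rV_setC rV_bigcup.
End measurable_rV.


Section defs.
Context (R : realType) (N : nat).
Local Notation V := 'rV[R]_N.

(** Euclidean norm on R^N (the library norm on 'rV is the max norm). *)
Definition enorm (z : V) : R := Num.sqrt (\sum_(i < N) z ord0 i ^+ 2).

Definition box (a b : V) : set V :=
  [set x | forall i : 'I_N, a ord0 i <= x ord0 i <= b ord0 i].

(** mu is the N-dimensional Lebesgue measure (on the product = Borel sigma-algebra):
    it gives every box its volume. This determines mu uniquely. *)
Definition is_lebesgue (mu : {measure set V -> \bar R}) : Prop :=
  forall a b : V, (forall i, a ord0 i <= b ord0 i) ->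
    mu (box a b) = (\prod_(i < N) (b ord0 i - a ord0 i))%:E.

Fixpoint iter_der (vs : seq V) (f : V -> R) : V -> R :=
  match vs with
  | [::] => f
  | v :: vs' => fun x => 'D_v (iter_der vs' f) x
  end.

Definition smooth_on (U : set V) (f : V -> R) : Prop :=
  forall (vs : seq V) (x : V), U x ->
    (forall v : V, derivable (iter_der vs f) x v) /\
    {for x, continuous (iter_der vs f)}.

Definition smooth_boundary (Om : set V) : Prop :=
  forall p : V, (closure Om `\` Om) p ->
    exists (r : R) (phi : V -> R), 0 < r /\
      smooth_on (ball p r) phi /\
      Om `&` ball p r = [set x | phi x < 0] `&` ball p r /\
      exists v : V, 'D_v phi p != 0.

Definition smooth_domain (Om : set V) : Prop :=
  open Om /\ Om !=set0 /\ bounded_set Om /\ connected Om /\ smooth_boundary Om.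

Definition kernel_assumptions (mu : {measure set V -> \bar R}) (J : V -> R) (d : R) : Prop :=
  [/\ measurable_fun setT J,
      (forall z, 0 <= J z),
      (forall z, J (- z) = J z) &
   [/\
      (\int[mu]_z (J z)%:E)%E = 1%E,
      0 < d,
      (forall z, d <= enorm z -> J z = 0) &
      (forall rho, 0 < rho < d -> exists c, 0 < c /\ forall z, enorm z < rho -> c <= J z)]].

Definition L2 (mu : {measure set V -> \bar R}) (Om : set V) (u : V -> R) : Prop :=
  measurable_fun Om u /\ (\int[mu]_(x in Om) ((u x) ^+ 2)%:E < +oo)%E.

Definition mean (mu : {measure set V -> \bar R}) (Om : set V) (u : V -> R) : R :=
  (fine (mu Om))^-1 * (\int[mu]_(x in Om) u x).

Definition ae_const (mu : {measure set V -> \bar R}) (Om : set V) (u : V -> R) : Prop :=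
  exists c : R, {ae mu, forall x, Om x -> u x = c}.

Definition dirichlet (mu : {measure set V -> \bar R}) (Om : set V) (J : V -> R)
  (u : V -> R) : \bar R :=
  (\int[mu]_(x in Om) \int[mu]_(y in Om) (J (x - y) * (u y - u x) ^+ 2)%:E)%E.

Definition variance (mu : {measure set V -> \bar R}) (Om : set V) (u : V -> R) : \bar R :=
  (\int[mu]_(x in Om) ((u x - mean mu Om u) ^+ 2)%:E)%E.

Definition beta (mu : {measure set V -> \bar R}) (Om : set V) (J : V -> R) : R :=
  inf [set r : R | exists u : V -> R, [/\ L2 mu Om u, ~ ae_const mu Om u &
         r = fine (dirichlet mu Om J u) / fine (variance mu Om u)]].

Definition neumann_op (mu : {measure set V -> \bar R}) (Om : set V) (J : V -> R)
  (v : V -> R) : V -> R :=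
  fun x => \int[mu]_(y in Om) (J (x - y) * (v y - v x)).

(** u : [0,oo) -> L^2(Om) is a (strong) solution of (N) with g = 0 and initial
    datum u0: u(t) in L^2(Om) for t >= 0, t |-> u(t) is differentiable in
    L^2(Om) on [0,oo) (one-sided at 0) with derivative L u(t), and u(0) = u0 a.e. *)
Definition solution (mu : {measure set V -> \bar R}) (Om : set V) (J : V -> R)
  (u0 : V -> R) (u : R -> V -> R) : Prop :=
  [/\ (forall t, 0 <= t -> L2 mu Om (u t)),
      (forall t, 0 <= t ->
         (\int[mu]_(x in Om)
            (((u (t + h) x - u t x) / h - neumann_op mu Om J (u t) x) ^+ 2)%:E)%E
           @[h --> within [set h : R | h != 0 /\ 0 <= t + h] (nbhs (0 : R))]
         --> 0%E) &
      {ae mu, forall x, Om x -> u 0 x = u0 x}].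

End defs.

(* Main.v *)
(** The Dirichlet form controls the variance by chaining: on a small ball [B]
    the kernel is bounded below, so the form bounds the variance of [u] on
    [B \cap Om]; the averages over two such sets are comparable when the sets
    overlap in positive measure, and since [Om] is connected and bounded finitely
    many overlapping balls link all of it.  Hence [beta > 0].  For the decay,
    symmetry of the kernel gives [2 <u - c, L u> = - dirichlet u] and
    [\int L u = 0]; so the mean is conserved, the squared distance to the mean
    has derivative [- dirichlet (u t) <= - beta * variance (u t)], and
    Gronwall's lemma concludes. *)
Require Import Defs.
From HB Require Import structures.
From mathcomp Require Import all_boot all_order all_algebra.
From mathcomp Require Import all_classical all_reals all_analysis.
From mathcomp Require Import ring lra measurable_realfun.
Import Order.TTheory GRing.Theory Num.Theory.
Import numFieldNormedType.Exports.
Local Open Scope classical_set_scope.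
Local Open Scope ring_scope.

Set Implicit Arguments.
Unset Strict Implicit.
Unset Printing Implicit Defensive.

(** * Square-integrable functions *)

(** The analysis is done on a finite measure space, for total functions and a symmetric kernel; the
    problem on [Om] is recovered by restricting [mu] to [Om] and extending functions by zero.
    Besides symmetry, the kernel enters through its rows [J (x - y)]: mass at most 1 makes the
    Dirichlet form finite on L^2, and square integrability makes the operator a genuine integral at
    every point. Both come from the invariance of [mu] under [y |-> x - y], which is derived from
    the volumes of boxes. In the chaining the constant worsens at every link, so connectedness alone
    gives each point of [Om] a constant of its own; compactness of the closure leaves finitely many
    of them. All balls are compared with one reference value, the average over a fixed ball, so that
    the estimates add up; only at the end does the mean replace it, being the constant closest to
    [u] in L^2. *)

Section real_integrable.
Context d (T : measurableType d) (R : realType).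
Variable nu : {measure set T -> \bar R}.
Implicit Types (f g : T -> R) (A : set T).

Lemma integrableZR c f A : measurable A -> nu.-integrable A (EFin \o f) ->
  nu.-integrable A (EFin \o (fun x => c * f x)).
Proof. by move=> mA fi; exact: (integrableZl mA c fi). Qed.

Lemma integrableDR f g A : measurable A ->
  nu.-integrable A (EFin \o f) -> nu.-integrable A (EFin \o g) ->
  nu.-integrable A (EFin \o (fun x => f x + g x)).
Proof. by move=> mA fi gi; exact: (integrableD mA fi gi). Qed.

Lemma le_integrableR f g A : measurable A -> measurable_fun A f ->
  (forall x, A x -> `|f x| <= g x) -> nu.-integrable A (EFin \o g) ->
  nu.-integrable A (EFin \o f).
Proof.
move=> mA mf fg; apply: le_integrable => //; first exact/measurable_EFinP.
by move=> x Ax /=; rewrite lee_fin (le_trans (fg x Ax))// ler_norm.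
Qed.

Lemma EFin_Rintegral f A : measurable A -> nu.-integrable A (EFin \o f) ->
  (\int[nu]_(x in A) f x)%:E = (\int[nu]_(x in A) (f x)%:E)%E.
Proof. by move=> mA fi; rewrite /Rintegral fineK//; exact: integrable_fin_num fi. Qed.

End real_integrable.

Section square_integrable.
Context d (T : measurableType d) (R : realType).
Variable nu : {finite_measure set T -> \bar R}.

Implicit Types f g : T -> R.

Definition sqint (f : T -> R) :=
  measurable_fun setT f /\ (\int[nu]_x (f x ^+ 2)%:E < +oo)%E.

Lemma sqint_integrable_sq f : sqint f ->
  nu.-integrable setT (EFin \o (fun x => f x ^+ 2)).
Proof.
move=> [mf foo]; apply/integrableP; split.
  by apply/measurable_EFinP; exact: measurable_funX.
by under eq_integral do rewrite gee0_abs ?lee_fin ?sqr_ge0//.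
Qed.

Lemma integrable_sq_sqint f : measurable_fun setT f ->
  nu.-integrable setT (EFin \o (fun x => f x ^+ 2)) -> sqint f.
Proof. by move=> mf /integrable_lty foo; split => //; exact: foo. Qed.

Lemma sqint_mul f g : sqint f -> sqint g ->
  nu.-integrable setT (EFin \o (fun x => f x * g x)).
Proof.
move=> hf hg.
have Ifg := integrableDR measurableT (sqint_integrable_sq hf) (sqint_integrable_sq hg).
apply: (le_integrableR _ _ _ Ifg) => //.
  by apply: measurable_funM; [exact: hf.1|exact: hg.1].
by move=> x _; rewrite ler_norml; apply/andP; split; nra.
Qed.

Lemma sqint_cst c : sqint (cst c).
Proof.
split; first exact: measurable_cst.
have := finite_measure_integrable_cst nu (c ^+ 2) measurableT.
by move=> /(integrable_lty measurableT).
Qed.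

Lemma sqint_lin a b f g : sqint f -> sqint g ->
  sqint (fun x => a * f x + b * g x).
Proof.
move=> hf hg; apply: integrable_sq_sqint.
  by apply: measurable_funD; apply: measurable_funM => //; [exact: hf.1|exact: hg.1].
have If := integrableZR (2 * a ^+ 2) measurableT (sqint_integrable_sq hf).
have Ig := integrableZR (2 * b ^+ 2) measurableT (sqint_integrable_sq hg).
apply: (le_integrableR _ _ _ (integrableDR _ If Ig)) => //.
  apply: measurable_funX.
  by apply: measurable_funD; apply: measurable_funM => //; [exact: hf.1|exact: hg.1].
move=> x _; rewrite ger0_norm ?sqr_ge0//.
by have := sqr_ge0 (a * f x - b * g x); nra.
Qed.

Lemma sqintB f g : sqint f -> sqint g -> sqint (fun x => f x - g x).
Proof.
move=> hf hg; have := sqint_lin 1 (-1) hf hg.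
by under eq_fun do rewrite mul1r mulN1r.
Qed.

Lemma sqintZ a f : sqint f -> sqint (fun x => a * f x).
Proof.
move=> hf; have := sqint_lin a 0 hf hf.
by under eq_fun do rewrite mul0r addr0.
Qed.

Lemma sqint_integrable f : sqint f -> nu.-integrable setT (EFin \o f).
Proof.
move=> hf; have := sqint_mul hf (sqint_cst 1).
by under [X in EFin \o X]eq_fun do rewrite /cst mulr1.
Qed.

Lemma Rintegral_sq_ge0 f : 0 <= \int[nu]_x (f x ^+ 2).
Proof. by apply: Rintegral_ge0 => x _; exact: sqr_ge0. Qed.

Lemma cauchy_schwarz_Rintegral f g : sqint f -> sqint g ->
  (\int[nu]_x (f x * g x)) ^+ 2 <=
  (\int[nu]_x (f x ^+ 2)) * (\int[nu]_x (g x ^+ 2)).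
Proof.
move=> hf hg; set F := Rintegral nu _ (fun x => f x ^+ 2).
set G := Rintegral nu _ (fun x => g x ^+ 2).
set P := Rintegral nu _ _.
have key a b : 0 <= a ^+ 2 * F + 2 * a * b * P + b ^+ 2 * G.
  suff -> : a ^+ 2 * F + 2 * a * b * P + b ^+ 2 * G =
     \int[nu]_x ((a * f x + b * g x) ^+ 2) by exact: Rintegral_sq_ge0.
  rewrite /F /P /G -!RintegralZl//; try exact: sqint_integrable_sq; last exact: sqint_mul.
  rewrite -!RintegralD//; do ?[exact: integrableDR
    | exact/integrableZR/sqint_integrable_sq | exact/integrableZR/sqint_mul].
    by apply: eq_Rintegral => x _; ring.
  by apply: integrableDR => //; apply: integrableZR => //;
    [exact: sqint_integrable_sq|exact: sqint_mul].
have F0 : 0 <= F by exact: Rintegral_sq_ge0.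
have G0 : 0 <= G by exact: Rintegral_sq_ge0.
have [G00|Gn0] := eqVneq G 0.
  have [->|Pn0] := eqVneq P 0; first by rewrite expr0n mulr_ge0.
  (* With [G = 0] the form is affine in [b], and this [b] gives it the value -1. *)
  have := key 1 (- (F + 1) / (2 * P)); rewrite G00.
  have -> : 1 ^+ 2 * F + 2 * 1 * (- (F + 1) / (2 * P)) * P + (- (F + 1) / (2 * P)) ^+ 2 * 0 = -1.
    by field.
  by lra.
(* For [a = G] the form is smallest at [b = - P]. *)
have := key G (- P).
have -> : G ^+ 2 * F + 2 * G * - P * P + (- P) ^+ 2 * G = G * (F * G - P ^+ 2) by ring.
by rewrite pmulr_rge0 ?lt_def ?Gn0// subr_ge0.
Qed.

End square_integrable.

(** * Nonlocal operators with a symmetric kernel *)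

Section kernel.
Context d (T : measurableType d) (R : realType).
Variable nu : {finite_measure set T -> \bar R}.
Variable k : T * T -> R.
Hypothesis mk : measurable_fun setT k.
Hypothesis k_ge0 : forall z, 0 <= k z.
Hypothesis kC : forall x y, k (x, y) = k (y, x).
Hypothesis k_le1 : forall x, (\int[nu]_y (k (x, y))%:E <= 1)%E.
Hypothesis k_sq : forall x, (\int[nu]_y (k (x, y) ^+ 2)%:E < +oo)%E.
Implicit Types u w : T -> R.

Let L u x := \int[nu]_y (k (x, y) * (u y - u x)).
Let D u := (\int[nu]_x \int[nu]_y (k (x, y) * (u y - u x) ^+ 2)%:E)%E.

Let m1 u : measurable_fun setT u -> measurable_fun setT (fun z : T * T => u z.1).
Proof. by move=> mu; exact: measurableT_comp. Qed.

Let m2 u : measurable_fun setT u -> measurable_fun setT (fun z : T * T => u z.2).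
Proof. by move=> mu; exact: measurableT_comp. Qed.

(** Integrating in [y] first costs only the mass of a row, so the double integral is at most that of
    [u ^+ 2]. *)
Lemma kernel_sq_integrable1 u : sqint nu u ->
  (nu \x nu)%E.-integrable setT (EFin \o (fun z => k z * u z.1 ^+ 2)).
Proof.
move=> hu; have mku : measurable_fun setT (fun z => k z * u z.1 ^+ 2).
  by apply: measurable_funM => //; apply: measurable_funX; exact: m1 hu.1.
apply/integrable12ltyP; first exact/measurable_EFinP.
apply: le_lt_trans hu.2; apply: ge0_le_integral => //.
- by move=> x _; apply: integral_ge0 => y _; exact: abse_ge0.
- apply: (measurable_fun_fubini_tonelli_F (abse \o (EFin \o (fun z => k z * u z.1 ^+ 2)))) => //=.
  by apply: measurableT_comp => //; exact/measurable_EFinP.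
- by apply/measurable_EFinP; apply: measurable_funX; exact: hu.1.
move=> x _; rewrite (eq_integral (fun y => (u x ^+ 2)%:E * (k (x, y))%:E)%E); last first.
  by move=> y _ /=; rewrite ger0_norm; [rewrite mulrC EFinM | rewrite mulr_ge0 // sqr_ge0].
rewrite ge0_integralZl_EFin ?sqr_ge0//; last first.
  by apply/measurable_EFinP; exact: measurableT_comp mk (pair1_measurable x).
  by move=> y _; rewrite lee_fin.
by rewrite -[leRHS]mule1; apply: lee_wpmul2l; rewrite ?lee_fin ?sqr_ge0.
Qed.

(** The two sides are the two iterated integrals of [f], which agree by Fubini. *)
Lemma integral_swap (f : T * T -> R) : (nu \x nu)%E.-integrable setT (EFin \o f) ->
  (nu \x nu)%E.-integrable setT (EFin \o (f \o unstable.swap)) /\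
  \int[(nu \x nu)%E]_z f (unstable.swap z) = \int[(nu \x nu)%E]_z f z.
Proof.
move=> fi; have /measurable_EFinP mf := measurable_int _ fi.
have mfs : measurable_fun setT (f \o unstable.swap).
  by apply: measurableT_comp => //; exact: measurable_swap.
have fsi : (nu \x nu)%E.-integrable setT (EFin \o (f \o unstable.swap)).
  apply/integrable12ltyP; first exact/measurable_EFinP.
  by apply/(@integrable21ltyP _ _ _ _ _ nu nu (EFin \o f)) => //; exact/measurable_EFinP.
split => //; rewrite /Rintegral -integral12_prod_meas1//.
by rewrite -(integral21_prod_meas1 fi).
Qed.

Lemma kernel_sq_integrable2 u : sqint nu u ->
  (nu \x nu)%E.-integrable setT (EFin \o (fun z => k z * u z.2 ^+ 2)).
Proof.
move=> /kernel_sq_integrable1/integral_swap[+ _].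
by apply: eq_integrable => // -[x y] _ /=; rewrite kC.
Qed.

Lemma kernel_form_integrable u w : sqint nu u -> sqint nu w ->
  (nu \x nu)%E.-integrable setT (EFin \o (fun z => k z * (w z.1 * (u z.2 - u z.1)))).
Proof.
move=> hu hw; have I1 := kernel_sq_integrable1 hw; have I2 := kernel_sq_integrable1 hu.
have I3 := kernel_sq_integrable2 hu.
apply: (le_integrableR _ _ _ (integrableDR _ I1 (integrableDR _ I2 I3))) => //.
  apply: measurable_funM => //; apply: measurable_funM; first exact: m1 hw.1.
  by apply: measurable_funB; [exact: m2 hu.1|exact: m1 hu.1].
move=> -[x y] _ /=; rewrite -!mulrDr normrM (ger0_norm (k_ge0 _)) ler_wpM2l//.
rewrite ler_norml; have := (sqr_ge0 (w x + u y), sqr_ge0 (w x - u y)).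
by move=> []; have := (sqr_ge0 (w x + u x), sqr_ge0 (w x - u x)) => -[]; nra.
Qed.

(** By symmetry of [k] the integrand is minus the sum of the integrand of [kernel_form_integrable]
    and its swap. *)
Lemma dirichlet_form_integrable u w : sqint nu u -> sqint nu w ->
  (nu \x nu)%E.-integrable setT
    (EFin \o (fun z => k z * ((w z.2 - w z.1) * (u z.2 - u z.1)))).
Proof.
move=> hu hw; have I1 := kernel_form_integrable hu hw.
have [I2 _] := integral_swap I1.
apply: eq_integrable (integrableDR _ (integrableZR (-1) _ I1) (integrableZR (-1) _ I2)) => //.
by move=> -[x y] _ /=; congr EFin; rewrite (kC y x); ring.
Qed.

(** Here the square integrability of the rows enters: [L u x] is a true integral for every [x], not
    a default value of [fine]. *)
Lemma kernel_op_integrable u x : sqint nu u ->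
  nu.-integrable setT (EFin \o (fun y => k (x, y) * (u y - u x))).
Proof.
move=> hu; apply: sqint_mul; last exact: sqintB hu (sqint_cst nu (u x)).
by split => //; exact: measurableT_comp mk (pair1_measurable x).
Qed.

(** [L u] is the inner integral of the pairing integrand with [w = 1], hence measurable by
    Fubini. *)
Lemma measurable_kernel_op u : sqint nu u -> measurable_fun setT (L u).
Proof.
move=> hu; have := kernel_form_integrable hu (sqint_cst nu 1).
move=> /measurable_fubini_F mF.
rewrite (_ : L u = fine \o
  fubini_F nu (EFin \o (fun z => k z * (cst 1 z.1 * (u z.2 - u z.1))))).
  by apply: measurableT_comp mF; exact: fine_measurable.
apply/funext => x; congr fine; apply: eq_integral => y _ /=.
by rewrite mul1r.
Qed.

(* Symmetrizing in x and y turns the pairing with L u into the Dirichlet form. *)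
Lemma kernel_op_by_parts u w : sqint nu u -> sqint nu w ->
  2 * \int[nu]_x (w x * L u x) =
  - \int[(nu \x nu)%E]_z (k z * ((w z.2 - w z.1) * (u z.2 - u z.1))).
Proof.
move=> hu hw; have I1 := kernel_form_integrable hu hw.
have [I2 E2] := integral_swap I1.
have -> : \int[nu]_x (w x * L u x) =
    \int[(nu \x nu)%E]_z (k z * (w z.1 * (u z.2 - u z.1))).
  rewrite [RHS]/Rintegral -integral12_prod_meas1//; congr fine.
  apply: eq_integral => x _; rewrite /fubini_F /= EFinM.
  rewrite /L EFin_Rintegral//; last exact: kernel_op_integrable.
  rewrite -integralZl//; last exact: kernel_op_integrable.
  by apply: eq_integral => y _; rewrite -EFinM; congr EFin; ring.
rewrite mulr2n mulrDl mul1r -{2}E2 -RintegralD//.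
rewrite -[RHS]mulN1r -RintegralZl//; last exact: dirichlet_form_integrable.
by apply: eq_Rintegral => -[x y] _ /=; rewrite (kC y x); ring.
Qed.

Lemma kernel_op_mean0 u : sqint nu u -> \int[nu]_x L u x = 0.
Proof.
move=> hu; have := kernel_op_by_parts hu (sqint_cst nu 1).
under [X in - X]eq_Rintegral do rewrite subrr mul0r mulr0.
rewrite Rintegral_cst// mul0r oppr0.
under eq_Rintegral do rewrite mul1r.
by move/eqP; rewrite mulf_eq0 pnatr_eq0 /= => /eqP.
Qed.

Lemma dirichletE u : sqint nu u ->
  D u = (\int[(nu \x nu)%E]_z (k z * ((u z.2 - u z.1) * (u z.2 - u z.1))))%:E.
Proof.
move=> hu; have I := dirichlet_form_integrable hu hu.
by rewrite EFin_Rintegral// -integral12_prod_meas1.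
Qed.

(** The quotients defining [beta] are built with [fine], which sends infinity to 0; finiteness makes
    them the intended ones. *)
Lemma dirichlet_fin_num u : sqint nu u -> D u \is a fin_num.
Proof. by move=> hu; rewrite dirichletE. Qed.

Lemma kernel_op_dirichlet u c : sqint nu u ->
  2 * \int[nu]_x ((u x - c) * L u x) = - fine (D u).
Proof.
move=> hu; rewrite (kernel_op_by_parts hu (sqintB hu (sqint_cst nu c))).
rewrite dirichletE//=; congr (- _); apply: eq_Rintegral => z _ /=.
by congr (_ * (_ * _)); rewrite /cst; ring.
Qed.

End kernel.

(** * Differential inequalities on the half-line *)

Section half_line_derivative.
Context (R : realType).
Implicit Types (f g : R -> R) (t : R).

(** The filter used in [solution]: punctured and two-sided for [t > 0], right-sided for [t = 0]. *)
Definition half_line_increments t : set_system R :=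
  within [set h : R | h != 0 /\ 0 <= t + h] (nbhs (0 : R)).
Local Notation incr := half_line_increments.

Global Instance increments_filter t : Filter (incr t).
Proof. exact: within_filter. Qed.

Lemma increments_near t : \forall h \near incr t, h != 0 /\ 0 <= t + h.
Proof. exact: withinT. Qed.

Lemma at_right_increments t : 0 <= t -> (0 : R)^'+ `=>` incr t.
Proof.
move=> t0 P HP; rewrite /incr /= in HP.
have HP' : \forall h \near (0 : R)^'+, h != 0 /\ 0 <= t + h -> P h.
  by apply: cvg_within; exact: HP.
near=> h; have h0 : 0 < h by near: h; exact: nbhs_right_gt.
have : h != 0 /\ 0 <= t + h -> P h by near: h.
by apply; rewrite gt_eqF// addr_ge0// ltW.
Unshelve. all: by end_near. Qed.

Lemma increments_dnbhs t : incr t `=>` (0 : R)^'.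
Proof.
move=> P; rewrite /= /dnbhs /incr /within /= => HP.
by near=> h => -[h0 _]; move: h0; near: h.
Unshelve. all: by end_near. Qed.

Lemma dnbhs_increments t : 0 < t -> (0 : R)^' `=>` incr t.
Proof.
move=> t0 P; rewrite /= /dnbhs /incr /within /= => HP.
near=> h => h0.
have : h != 0 /\ 0 <= t + h -> P h by near: h.
apply; split => //; rewrite -lerBlDl sub0r ltW//; near: h.
by apply: lt_nbhsr; rewrite oppr_lt0.
Unshelve. all: by end_near. Qed.

(** Mean value theorem on [[0, t]]. At interior points the increments give an ordinary derivative;
    at 0 the right derivative provides the continuity required at the endpoint. *)
Lemma le_of_derivative_le0 f f' :
  (forall t, 0 <= t -> (f (t + h) - f t) / h @[h --> incr t] --> f' t) ->
  (forall t, 0 <= t -> f' t <= 0) -> forall t, 0 <= t -> f t <= f 0.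
Proof.
move=> df f'0 t; rewrite le_eqVlt => /predU1P[<-//|t0].
have dfP (x : R) : 0 < x -> is_derive x 1 f (f' x).
  move=> x0; have : (fun h => h^-1 *: ((f \o shift x) (h *: 1) - f x)) @ 0^' --> f' x.
    apply: (cvg_trans (cvg_trans _ _)) (df x (ltW x0)); last exact: cvg_app (dnbhs_increments x0).
    apply: near_eq_cvg; near=> h => /=.
    rewrite /shift/= /GRing.scale/= mulr1.
    by rewrite mulrC [h + x]addrC.
  by move=> dx; apply: DeriveDef; [apply/cvg_ex; exists (f' x)|exact: cvg_lim dx].
have [x||c c0t e] := @MVT _ f f' 0 t t0.
- by rewrite in_itv/= => /andP[x0 _]; exact: dfP.
- apply/continuous_within_itvP => //; split.
  + move=> x; rewrite in_itv/= => /andP[x0 _].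
    by apply: differentiable_continuous; apply/derivable1_diffP; have [] := dfP x x0.
  + have q : (f (0 + h) - f 0) / h @[h --> (0 : R)^'+] --> f' 0.
      exact: cvg_trans (cvg_app _ (at_right_increments (lexx 0))) (df 0 (lexx 0)).
    have h0 : h @[h --> (0 : R)^'+] --> (0 : R) by exact: cvg_at_right_filter cvg_id.
    have fE : f 0 + h * ((f (0 + h) - f 0) / h) @[h --> (0 : R)^'+] --> f 0.
      by rewrite -[X in _ --> X]addr0 -[X in _ + X](mul0r (f' 0)); apply: cvgD;
        [exact: cvg_cst|exact: cvgM].
    apply: cvg_trans fE; apply: near_eq_cvg; near=> h.
    by rewrite add0r mulrC divfK ?subrKC// gt_eqF.
  + have ft : {for t, continuous f}.
      by apply: differentiable_continuous; apply/derivable1_diffP; have [] := dfP t t0.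
    exact: (cvg_at_left_filter ft).
rewrite -subr_le0 e subr0 mulr_le0_ge0 ?(ltW t0)// f'0//.
by move: c0t; rewrite in_itv/= => /andP[/ltW].
Unshelve. all: by end_near. Qed.

Lemma gronwall f f' b :
  (forall t, 0 <= t -> (f (t + h) - f t) / h @[h --> incr t] --> f' t) ->
  (forall t, 0 <= t -> f' t <= - b * f t) ->
  forall t, 0 <= t -> f t <= expR (- (b * t)) * f 0.
Proof.
move=> df f'le t t0.
pose g s := expR (b * s) * f s.
pose g' s := expR (b * s) * f' s + f s * (b * expR (b * s)).
suff : g t <= g 0.
  by rewrite /g mulr0 expR0 mul1r expRN [_^-1 * _]mulrC ler_pdivlMr ?expR_gt0// [f t * _]mulrC.
apply: (@le_of_derivative_le0 g g') => // s s0; last first.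
  rewrite /g'; have := ler_wpM2l (expR_ge0 (b * s)) (f'le s s0); nra.
have dE : is_derive s 1 (expR \o (b \*: (@id R))) (b * expR (b * s)).
  apply: is_derive_eq; rewrite /= /GRing.scale/= mulr1; exact: mulrC.
have e1 : (expR (b * (s + h)) - expR (b * s)) / h @[h --> incr s] --> b * expR (b * s).
  have q : (fun h => h^-1 *: ((expR \o (b \*: (@id R)) \o shift s) (h *: 1)
      - (expR \o (b \*: (@id R))) s)) @ incr s --> b * expR (b * s).
    apply: cvg_trans (cvg_app _ (increments_dnbhs s)) _.
    by rewrite -(@derive_val _ _ _ _ _ _ _ dE); exact: (@ex_derive _ _ _ _ _ _ _ dE).
  apply: cvg_trans q; apply: near_eq_cvg; near=> h => /=.
  by rewrite /shift/= /GRing.scale/= mulr1 mulrC [h + s]addrC.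
have e2 : expR (b * (s + h)) @[h --> incr s] --> expR (b * s).
  have h0 : h @[h --> incr s] --> (0 : R) by exact: cvg_within.
  have sh : b * (s + h) @[h --> incr s] --> b * (s + 0).
    exact: cvgM (cvg_cst _) (cvgD (cvg_cst _) h0).
  rewrite addr0 in sh.
  by apply: (continuous_cvg _ _ sh); exact: continuous_expR.
(* In this form of the product rule the shifted factor is the exponential, whose continuity is at
   hand. *)
have gE : expR (b * (s + h)) * ((f (s + h) - f s) / h) +
    f s * ((expR (b * (s + h)) - expR (b * s)) / h) @[h --> incr s] --> g' s.
  by apply: cvgD; [exact: cvgM e2 (df s s0)|exact: cvgM (cvg_cst _) e1].
by apply: cvg_trans gE; apply: near_eq_cvg; near=> h; rewrite /g; ring.
Unshelve. all: by end_near. Qed.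

End half_line_derivative.

(** * Decay of solutions *)

Section L2_limits.
Context d (T : measurableType d) (R : realType).
Variable nu : {finite_measure set T -> \bar R}.
Context (I : Type) (F : set_system I) {FF : Filter F}.
Variables (q : I -> T -> R) (v : T -> R).
Hypothesis hq : \forall i \near F, sqint nu (q i).
Hypothesis hv : sqint nu v.
Hypothesis q_cvg : (\int[nu]_x ((q i x - v x) ^+ 2)%:E)%E @[i --> F] --> 0%E.

Let e_cvg : \int[nu]_x ((q i x - v x) ^+ 2) @[i --> F] --> (0 : R).
Proof. exact: fine_cvg q_cvg. Qed.

Lemma L2_limit_pairing g : sqint nu g ->
  \int[nu]_x (q i x * g x) @[i --> F] --> \int[nu]_x (v x * g x).
Proof.
move=> hg; set G := \int[nu]_x (g x ^+ 2).
have s0 : Num.sqrt (\int[nu]_x ((q i x - v x) ^+ 2) * G) @[i --> F] --> (0 : R).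
  have eG : \int[nu]_x ((q i x - v x) ^+ 2) * G @[i --> F] --> 0 * G.
    by apply: cvgM e_cvg _; exact: cvg_cst.
  by rewrite mul0r in eG; rewrite -sqrtr0; apply: (continuous_cvg _ _ eG); exact: sqrt_continuous.
apply: (@cvg_sub0 _ _ _ _ _ _ (fun=> \int[nu]_x (v x * g x))); last exact: cvg_cst.
apply: norm_cvg0; apply: squeeze_cvgr (cvg_cst 0) s0.
near=> i; have hqi : sqint nu (q i) by near: i.
rewrite normr_ge0/= -sqrtr_sqr ler_wsqrtr//.
have -> : ((fun i => \int[nu]_x (q i x * g x)) - (fun=> \int[nu]_x (v x * g x))) i =
    \int[nu]_x ((q i x - v x) * g x).
  rewrite -[LHS]/(\int[nu]_x (q i x * g x) - \int[nu]_x (v x * g x)).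
  rewrite -RintegralB//; try exact: sqint_mul.
  by apply: eq_Rintegral => x _; rewrite mulrBl.
by apply: cauchy_schwarz_Rintegral => //; exact: sqintB.
Unshelve. all: by end_near. Qed.

(** The norms of [q i] stay bounded because [q ^+ 2 <= 2 (q - v) ^+ 2 + 2 v ^+ 2]. This disposes of
    the second-order term when a squared distance is differentiated. *)
Lemma L2_limit_sq_bound (h : I -> R) : h i @[i --> F] --> (0 : R) ->
  h i * \int[nu]_x (q i x ^+ 2) @[i --> F] --> (0 : R).
Proof.
move=> h0; set V := \int[nu]_x (v x ^+ 2).
pose B i := `|h i| * (2 * \int[nu]_x ((q i x - v x) ^+ 2) + 2 * V).
have B0 : B i @[i --> F] --> `|0 : R| * (2 * 0 + 2 * V).
  apply: cvgM; first exact: cvg_norm.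
  by apply: cvgD; [apply: cvgM e_cvg; exact: cvg_cst|exact: cvg_cst].
rewrite normr0 mul0r in B0.
apply: norm_cvg0; apply: squeeze_cvgr (cvg_cst 0) B0.
near=> i; have hqi : sqint nu (q i) by near: i.
rewrite normr_ge0/= normrM /B ler_wpM2l// ger0_norm ?Rintegral_sq_ge0//.
rewrite /V -!RintegralZl//; try exact: sqint_integrable_sq;
  last exact/sqint_integrable_sq/sqintB.
have I1 := integrableZR 2 measurableT (sqint_integrable_sq (sqintB hqi hv)).
have I2 := integrableZR 2 measurableT (sqint_integrable_sq hv).
rewrite -RintegralD//; apply: le_Rintegral => //; first exact: sqint_integrable_sq.
  exact: integrableDR.
by move=> x _; have := sqr_ge0 (q i x - 2 * v x); nra.
Unshelve. all: by end_near. Qed.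

End L2_limits.
Arguments L2_limit_pairing {d T R nu I F FF q v} _ _ _ {g} _ _ _.
Arguments L2_limit_sq_bound {d T R nu I F FF q v} _ _ _ {h} _ _ _.

(** * Conservation of the mean and decay of the variance *)

Section decay.
Context d (T : measurableType d) (R : realType).
Variable nu : {finite_measure set T -> \bar R}.
Variable k : T * T -> R.
Hypothesis mk : measurable_fun setT k.
Hypothesis k_ge0 : forall z, 0 <= k z.
Hypothesis kC : forall x y, k (x, y) = k (y, x).
Hypothesis k_le1 : forall x, (\int[nu]_y (k (x, y))%:E <= 1)%E.
Hypothesis k_sq : forall x, (\int[nu]_y (k (x, y) ^+ 2)%:E < +oo)%E.

Let L u x := \int[nu]_y (k (x, y) * (u y - u x)).
Let D u := (\int[nu]_x \int[nu]_y (k (x, y) * (u y - u x) ^+ 2)%:E)%E.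
Let mean (u : T -> R) := (fine (nu setT))^-1 * \int[nu]_x u x.

Variable b : R.
Hypothesis poincare : forall u, sqint nu u ->
  b * \int[nu]_x ((u x - mean u) ^+ 2) <= fine (D u).

Variable u : R -> T -> R.
Hypothesis u_sqint : forall t, 0 <= t -> sqint nu (u t).
Hypothesis u_derive : forall t, 0 <= t ->
  (\int[nu]_x (((u (t + h) x - u t x) / h - L (u t) x) ^+ 2)%:E)%E
    @[h --> half_line_increments t] --> 0%E.

Let q t h x := (u (t + h) x - u t x) / h.

Let q_sqint t : 0 <= t -> \forall h \near half_line_increments t, sqint nu (q t h).
Proof.
move=> t0; apply: filterS (increments_near t) => h -[h0 th0].
rewrite /q; under eq_fun do rewrite mulrC.
by apply: sqintZ; apply: sqintB; exact: u_sqint.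
Qed.

(* No estimate of L on L^2 is needed: L (u t) is an L^2 limit. *)
Let Lu_sqint t : 0 <= t -> sqint nu (L (u t)).
Proof.
move=> t0; have mL : measurable_fun setT (L (u t)).
  exact: (measurable_kernel_op mk k_ge0 kC k_le1 (u_sqint t0)).
(* Convergence to 0 makes the distance finite for some admissible [h]; then [L (u t)] is the
   difference of two square-integrable functions. *)
have noo : nbhs (0%E : \bar R) [set y | (y < +oo)%E].
  by apply: open_nbhs_nbhs; split; [exact: open_ereal_lt_ereal|exact: ltry].
have fin := @u_derive t t0 _ noo.
have near1 : \forall h \near half_line_increments t,
    sqint nu (q t h) /\ sqint nu (fun x => q t h x - L (u t) x).
  near=> h; have hq : sqint nu (q t h) by near: h; exact: q_sqint.
  split => //; split; first by apply: measurable_funB => //; exact: hq.1.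
  by near: h; exact: fin.
have [h [hq he]] := filter_ex (at_right_increments t0 near1).
have := sqintB hq he; congr sqint; apply/funext => x; ring.
Unshelve. all: by end_near. Qed.

Lemma mean_conserved t : 0 <= t -> mean (u t) = mean (u 0).
Proof.
move=> t0; congr (_ * _).
have dM s : 0 <= s ->
    (\int[nu]_x u (s + h) x - \int[nu]_x u s x) / h @[h --> half_line_increments s] --> (0 : R).
  move=> s0; have c : \int[nu]_x (q s h x * cst 1 x) @[h --> half_line_increments s]
      --> \int[nu]_x (L (u s) x * cst 1 x).
    exact (L2_limit_pairing (q_sqint s0) (Lu_sqint s0) (@u_derive s s0) (sqint_cst nu 1)).
  have c0 : \int[nu]_x (L (u s) x * cst 1 x) = 0.
    under eq_Rintegral do rewrite mulr1.
    exact: (kernel_op_mean0 mk k_ge0 kC k_le1 k_sq (u_sqint s0)).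
  rewrite c0 in c; apply: cvg_trans c.
  apply: near_eq_cvg.
  apply: filterS (increments_near s) => h -[h0 sh0].
  have us := sqint_integrable (u_sqint s0); have uh := sqint_integrable (u_sqint sh0).
  rewrite -RintegralB// mulrC -RintegralZl//; last first.
    exact: sqint_integrable (sqintB (u_sqint sh0) (u_sqint s0)).
  by apply: eq_Rintegral => x _; rewrite /q mulr1 mulrC.
(* The derivative being zero, the one-sided comparison applies to the integral and to its
   opposite. *)
apply/eqP; rewrite eq_le; apply/andP; split.
  exact: (@le_of_derivative_le0 _ (fun s => \int[nu]_x u s x) (fun=> 0)).
rewrite -lerN2.
apply: (@le_of_derivative_le0 _ (fun s => - \int[nu]_x u s x) (fun=> 0)) => // s s0.
rewrite -oppr0; apply: cvg_trans (cvgN (dM s s0)).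
by apply: near_eq_cvg; near=> h; rewrite /= -[LHS]mulNr; congr (_ / _); ring.
Unshelve. all: by end_near. Qed.

Lemma variance_decay t : 0 <= t ->
  \int[nu]_x ((u t x - mean (u 0)) ^+ 2) <=
  expR (- (b * t)) * \int[nu]_x ((u 0 x - mean (u 0)) ^+ 2).
Proof.
set m := mean (u 0).
apply: (@gronwall _ (fun s => \int[nu]_x ((u s x - m) ^+ 2))
  (fun s => - fine (D (u s)))) => s s0; last first.
  by rewrite mulNr lerN2; have := poincare (u_sqint s0); rewrite mean_conserved.
have hg : sqint nu (fun x => u s x - m) by apply: sqintB (u_sqint s0) (sqint_cst nu m).
pose proof (c1 := L2_limit_pairing (q_sqint s0) (Lu_sqint s0) (@u_derive s s0) hg).
have h0 : h @[h --> half_line_increments s] --> (0 : R) by exact: cvg_within.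
pose proof (c2 := L2_limit_sq_bound (q_sqint s0) (Lu_sqint s0) (@u_derive s s0) h0).
(* Expanding [u (s + h) - m = (u s - m) + h q] shows that this is exactly the difference quotient of
   the squared distance. *)
have c : 2 * \int[nu]_x (q s h x * (u s x - m)) + h * \int[nu]_x (q s h x ^+ 2)
    @[h --> half_line_increments s] --> 2 * \int[nu]_x (L (u s) x * (u s x - m)) + 0.
  by apply: cvgD c2; exact: cvgM (cvg_cst _) c1.
have E : 2 * \int[nu]_x (L (u s) x * (u s x - m)) = - fine (D (u s)).
  rewrite -(kernel_op_dirichlet mk k_ge0 kC k_le1 k_sq m (u_sqint s0)).
  by congr (_ * _); apply: eq_Rintegral => x _; rewrite mulrC.
rewrite addr0 E in c; apply: cvg_trans c; apply: near_eq_cvg.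
apply: filterS (increments_near s) => h -[hn0 sh0].
have hgh : sqint nu (fun x => u (s + h) x - m) by apply: sqintB (u_sqint sh0) (sqint_cst nu m).
have hq : sqint nu (q s h).
  by rewrite /q; under eq_fun do rewrite mulrC; apply: sqintZ; apply: sqintB; exact: u_sqint.
have Iq := sqint_mul hq hg; have Iqq := sqint_integrable_sq hq.
rewrite -RintegralB//; [|exact: sqint_integrable_sq..].
have Id := integrableB measurableT (sqint_integrable_sq hgh) (sqint_integrable_sq hg).
rewrite [RHS]mulrC -[RHS]RintegralZl// -!RintegralZl//.
rewrite -RintegralD//; [|exact: integrableZR..].
by apply: eq_Rintegral => x _; rewrite /q; field.
Qed.

End decay.

(** * The Poincare inequality by chaining *)

Section poincare.
Context d (T : measurableType d) (R : realType).
Variable nu : {finite_measure set T -> \bar R}.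
Implicit Types (u f : T -> R) (A B : set T).

Lemma le_Rintegral_subset A B f : measurable A -> measurable B -> A `<=` B ->
  (forall x, 0 <= f x) -> nu.-integrable B (EFin \o f) ->
  \int[nu]_(x in A) f x <= \int[nu]_(x in B) f x.
Proof.
move=> mA mB AB f0 fB; have fA := integrableS mB mA AB fB.
rewrite -lee_fin !EFin_Rintegral//; apply: ge0_subset_integral => //.
- exact: measurable_int _ fB.
- by move=> x _; rewrite lee_fin.
Qed.

Lemma sqint_subset_integrable u c A : sqint nu u -> measurable A ->
  nu.-integrable A (EFin \o (fun x => (u x - c) ^+ 2)).
Proof.
move=> hu mA; apply: (integrableS measurableT) => //.
exact: sqint_integrable_sq (sqintB hu (sqint_cst nu c)).
Qed.

Definition average A u : R := (fine (nu A))^-1 * \int[nu]_(x in A) u x.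

(** Expanding around the average kills the cross term and leaves a nonnegative multiple of
    [nu A]. *)
Lemma mean_minimizes u c A : sqint nu u -> measurable A -> 0 < fine (nu A) ->
  \int[nu]_(x in A) ((u x - average A u) ^+ 2) <= \int[nu]_(x in A) ((u x - c) ^+ 2).
Proof.
move=> hu mA A0; set m := average A u.
have uA := integrableS measurableT mA (@subsetT _ A) (sqint_integrable hu).
have cA (a : R) : nu.-integrable A (EFin \o (fun=> a)).
  exact: finite_measure_integrable_cst.
have I1 := sqint_subset_integrable m hu mA.
have um : \int[nu]_(x in A) (u x - m) = 0.
  rewrite RintegralB// Rintegral_cst// /m /average mulrAC mulVf ?mul1r ?subrr//.
  by rewrite gt_eqF.
have IB : nu.-integrable A (EFin \o (fun x => u x - m)) by exact: (integrableB mA uA (cA m)).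
have I2 := integrableZR (2 * (m - c)) mA IB.
have -> : \int[nu]_(x in A) ((u x - c) ^+ 2) =
    \int[nu]_(x in A) ((u x - m) ^+ 2) + (m - c) ^+ 2 * fine (nu A).
  rewrite -Rintegral_cst// -[X in _ = X + _]addr0.
  rewrite -(mulr0 (2 * (m - c))) -um -RintegralZl// -RintegralD//.
  rewrite -RintegralD//; last exact: integrableDR.
  by apply: eq_Rintegral => x _; ring.
by rewrite lerDl mulr_ge0 ?sqr_ge0// ltW.
Qed.

Variable k : T * T -> R.
Hypothesis mk : measurable_fun setT k.
Hypothesis k_ge0 : forall z, 0 <= k z.
Hypothesis kC : forall x y, k (x, y) = k (y, x).
Hypothesis k_le1 : forall x, (\int[nu]_y (k (x, y))%:E <= 1)%E.

Let D u := (\int[nu]_x \int[nu]_y (k (x, y) * (u y - u x) ^+ 2)%:E)%E.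

(** For each [x] in [A] the value [u x] is a competitor for the average, so the variance on [A] is
    at most the integral of [(u y - u x) ^+ 2] over [y] in [A], on which [k >= c]. Integrating over
    [x] in [A] produces the factor [nu A]. *)
Lemma local_poincare u A c : sqint nu u -> measurable A -> 0 < fine (nu A) ->
  0 < c -> (forall x y, A x -> A y -> c <= k (x, y)) ->
  \int[nu]_(x in A) ((u x - average A u) ^+ 2) <= (c * fine (nu A))^-1 * fine (D u).
Proof.
move=> hu mA A0 c0 ck; set V := Rintegral _ _ _.
have V0 : 0 <= V by apply: Rintegral_ge0 => y _; exact: sqr_ge0.
rewrite ler_pdivlMl ?mulr_gt0//.
have -> : c * fine (nu A) * V = c * V * fine (nu A) by ring.
rewrite -Rintegral_cst// -lee_fin [leRHS]fineK; last first.
  exact: (dirichlet_fin_num mk k_ge0 kC k_le1 hu).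
rewrite EFin_Rintegral//; last exact: finite_measure_integrable_cst.
have mf : measurable_fun setT (fun z : T * T => k z * (u z.2 - u z.1) ^+ 2).
  apply: measurable_funM => //; apply: measurable_funX.
  by apply: measurable_funB; apply: measurableT_comp => //; exact: hu.1.
have f0 x y : 0 <= k (x, y) * (u y - u x) ^+ 2 by rewrite mulr_ge0// sqr_ge0.
have mF : measurable_fun setT (fun x => \int[nu]_y (k (x, y) * (u y - u x) ^+ 2)%:E)%E.
  apply: (measurable_fun_fubini_tonelli_F (EFin \o (fun z => k z * (u z.2 - u z.1) ^+ 2))).
    exact/measurable_EFinP.
  by move=> [x y]; rewrite lee_fin.
have F0 x : (0 <= \int[nu]_y (k (x, y) * (u y - u x) ^+ 2)%:E)%E.
  by apply: integral_ge0 => y _; rewrite lee_fin.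
have mfx x : measurable_fun setT (fun y => (k (x, y) * (u y - u x) ^+ 2)%:E).
  by apply/measurable_EFinP; exact: measurableT_comp mf (pair1_measurable x).
apply: (@le_trans _ _ (\int[nu]_(x in A)
    \int[nu]_y (k (x, y) * (u y - u x) ^+ 2)%:E)%E); last first.
  exact: ge0_subset_integral.
apply: ge0_le_integral => //.
- by move=> x _; rewrite lee_fin mulr_ge0// ltW.
- exact: measurable_funS mF.
move=> x Ax.
apply: (@le_trans _ _ (\int[nu]_(y in A) (k (x, y) * (u y - u x) ^+ 2)%:E)%E); last first.
  by apply: ge0_subset_integral => // y _; rewrite lee_fin.
have I1 := sqint_subset_integrable (u x) hu mA.
apply: (@le_trans _ _ (\int[nu]_(y in A) (c * (u y - u x) ^+ 2)%:E)%E).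
  rewrite -EFin_Rintegral ?RintegralZl//; last exact: integrableZR.
  by rewrite lee_fin ler_wpM2l ?(ltW c0)//; exact: mean_minimizes.
apply: ge0_le_integral => //.
- by move=> y _; rewrite lee_fin mulr_ge0 ?sqr_ge0 ?(ltW c0).
- by have /measurable_int := integrableZR c mA I1.
- exact: measurable_funS (mfx x).
- by move=> y Ay; rewrite lee_fin ler_wpM2r ?sqr_ge0// ck.
Qed.

(** The reference value [m0 u] does not depend on [A], which makes the property stable under unions;
    [K] precedes [u], the uniformity that bounds the quotients of [beta] from below. *)
Definition linked (m0 : (T -> R) -> R) A := exists K : R, 0 <= K /\
  forall u, sqint nu u -> \int[nu]_(x in A) ((u x - m0 u) ^+ 2) <= K * fine (D u).

Let D_ge0 u : 0 <= fine (D u).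
Proof.
apply: fine_ge0; apply: integral_ge0 => x _; apply: integral_ge0 => y _.
by rewrite lee_fin mulr_ge0 ?sqr_ge0.
Qed.

Lemma linkedU m0 A B : measurable A -> measurable B ->
  linked m0 A -> linked m0 B -> linked m0 (A `|` B).
Proof.
move=> mA mB [K [K0 hK]] [L [L0 hL]]; exists (K + L); split => [|u hu].
  exact: addr_ge0.
have mBA : measurable (B `\` A) by exact: measurableD.
rewrite (_ : A `|` B = A `|` (B `\` A)); last by rewrite setUDr setDv setD0.
rewrite Rintegral_setU//; last 2 first.
  exact: sqint_subset_integrable (measurableU _ _ mA mBA).
  by apply/disj_setPS; rewrite setDIK.
rewrite mulrDl lerD ?hK//; apply: le_trans (hL u hu).
apply: (le_Rintegral_subset mBA mB); first by move=> x [].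
  by move=> x; exact: sqr_ge0.
exact: sqint_subset_integrable.
Qed.

Lemma linked_null m0 A : measurable A -> nu A = 0%E -> linked m0 A.
Proof.
move=> mA A0; exists 0; split => // u hu; rewrite mul0r /Rintegral null_set_integral//.
exact: measurable_int _ (sqint_subset_integrable (m0 u) hu mA).
Qed.

(* The overlap bounds the distance from m0 u to the average of u over B. *)
Lemma linked_overlap m0 A B c : measurable A -> measurable B ->
  0 < fine (nu (A `&` B)) -> 0 < c ->
  (forall x y, B x -> B y -> c <= k (x, y)) ->
  linked m0 A -> linked m0 B.
Proof.
move=> mA mB AB0 c0 ck [K [K0 hK]].
have mAB := measurableI _ _ mA mB.
have B0 : 0 < fine (nu B).
  apply: lt_le_trans AB0 _; apply: fine_le; rewrite ?fin_num_measure//.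
  by apply: le_measure; rewrite ?inE.
set nB := fine (nu B); set nC := fine (nu (A `&` B)).
pose L := (c * nB)^-1; have L0 : 0 <= L by rewrite invr_ge0 mulr_ge0 ?ltW.
(* [2 * L] pays for the variance on [B]. The rest is [2 * nB] times the bound on the squared
   distance of the two reference values, obtained by integrating it over the overlap of mass
   [nC]. *)
exists (2 * L + 2 * (nC^-1 * (2 * K + 2 * L)) * nB); split => [|u hu].
  by do ?[apply: addr_ge0 | apply: mulr_ge0] => //; rewrite ?invr_ge0 ltW.
set m := m0 u; set m' := average B u.
have hL : \int[nu]_(x in B) ((u x - m') ^+ 2) <= L * fine (D u).
  exact: local_poincare.
have I a E (mE : measurable E) := sqint_subset_integrable a hu mE.
have C1 : (m - m') ^+ 2 * nC <= (2 * K + 2 * L) * fine (D u).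
  rewrite -Rintegral_cst//.
  apply: (@le_trans _ _ (\int[nu]_(x in A `&` B) (2 * (u x - m) ^+ 2 + 2 * (u x - m') ^+ 2))).
    apply: le_Rintegral => //; first exact: finite_measure_integrable_cst.
      by apply: integrableDR => //; apply: integrableZR => //; exact: I.
    by move=> x _; have := sqr_ge0 ((u x - m) + (u x - m')); nra.
  rewrite RintegralD ?RintegralZl//; do ?[exact: I | by apply: integrableZR => //; exact: I].
  rewrite [leRHS]mulrDl -!mulrA lerD// ler_wpM2l//.
    apply: le_trans (hK u hu); apply: le_Rintegral_subset => //; last exact: I.
    by move=> x; exact: sqr_ge0.
  apply: le_trans hL; apply: le_Rintegral_subset => //; last exact: I.
  by move=> x; exact: sqr_ge0.
have C2 : (m - m') ^+ 2 <= nC^-1 * (2 * K + 2 * L) * fine (D u).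
  by rewrite -mulrA ler_pdivlMl// mulrC.
apply: (@le_trans _ _ (\int[nu]_(x in B) (2 * (u x - m') ^+ 2 + 2 * (m - m') ^+ 2))).
  apply: le_Rintegral => //; first exact: I.
    apply: integrableDR => //; first by apply: integrableZR => //; exact: I.
    exact: finite_measure_integrable_cst.
  by move=> x _; have := sqr_ge0 ((u x - m') + (m - m')); nra.
rewrite RintegralD//; last 2 first.
  by apply: integrableZR => //; exact: I.
  exact: finite_measure_integrable_cst.
rewrite RintegralZl//; last exact: I.
rewrite Rintegral_cst// [leRHS]mulrDl lerD//.
  by rewrite -mulrA ler_wpM2l.
have -> : 2 * (nC^-1 * (2 * K + 2 * L)) * nB * fine (D u) =
  2 * (nC^-1 * (2 * K + 2 * L) * fine (D u)) * nB by ring.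
by rewrite ler_wpM2r ?(ltW B0)// ler_wpM2l.
Qed.

Lemma linked_poincare m0 : 0 < fine (nu setT) -> linked m0 setT ->
  exists K : R, 0 < K /\ forall u, sqint nu u ->
    \int[nu]_x ((u x - average setT u) ^+ 2) <= K * fine (D u).
Proof.
(* Adding 1 makes the constant positive, so that its inverse can bound [beta] from below. *)
move=> nu0 [K [K0 hK]]; exists (K + 1); split => [|u hu]; first exact: ltr_wpDl.
apply: le_trans (mean_minimizes (m0 u) hu measurableT nu0) _.
by rewrite (le_trans (hK u hu))// ler_wpM2r// lerDl.
Qed.

End poincare.

(** * Lebesgue measure on row vectors *)

Section rV_measurable.
Context (R : realType) (N : nat).
Local Notation V := 'rV[R]_N.

Lemma measurable_coord (i : 'I_N) : measurable_fun setT (fun x : V => x ord0 i).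
Proof.
move=> _ B mB; rewrite setTI; apply: sub_sigma_algebra.
rewrite -bigcup_seq/=; exists i => /=; first by rewrite mem_index_enum.
by exists B => //; rewrite setTI.
Qed.

Lemma measurable_fun_coord d (T : measurableType d) (f : T -> V) :
  (forall i, measurable_fun setT (fun t => f t ord0 i)) -> measurable_fun setT f.
Proof.
move=> mf; apply: (@measurability _ _ T V setT f
  (\big[setU/set0]_(i < N) preimage_set_system setT (fun x : V => x ord0 i) measurable)) => //.
move=> _ [B + <-]; rewrite -bigcup_seq/= => -[i _ [C mC <-]].
have := mf i measurableT C mC; rewrite !setTI; exact.
Qed.

Lemma measurable_subV : measurable_fun setT (fun z : V * V => z.1 - z.2).
Proof.
apply: measurable_fun_coord => i; under eq_fun do rewrite !mxE.
by apply: measurable_funB; apply: (measurableT_comp (@measurable_coord i)).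
Qed.

Lemma boxE (a b : V) : box a b =
  \bigcap_(i in [set: 'I_N]) ((fun x : V => x ord0 i) @^-1` `[a ord0 i, b ord0 i]%classic).
Proof.
apply/seteqP; split => x h i; first by move=> _ /=; rewrite in_itv/=; exact: h.
by have := h i I; rewrite /= in_itv.
Qed.

Lemma measurable_box (a b : V) : measurable (box a b).
Proof.
rewrite boxE; apply: fin_bigcap_measurable => // i _.
by rewrite -[X in measurable X]setTI; exact: measurable_coord.
Qed.

(** Boxes form a generating family stable under intersection, as the uniqueness theorem for measures
    requires. *)
Lemma measurable_rV_boxes :
  @measurable _ V = <<s [set A | exists a b : V, A = box a b] >>.
Proof.
set G := [set A | _]; apply/seteqP; split; last first.
  apply: smallest_sub; first exact: sigma_algebra_measurable.
  by move=> _ [a [b ->]]; exact: measurable_box.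
apply: smallest_sub; first exact: smallest_sigma_algebra.
move=> A; rewrite -bigcup_seq/= => -[i _ [B mB <-]]; rewrite setTI.
pose TG : measurableType _ := g_sigma_algebraType G.
suff mc : measurable_fun setT (fun x : TG => (x : V) ord0 i).
  by have := mc measurableT B mB; rewrite setTI.
apply: (@measurability _ _ TG R setT _ (@RGenCInfty.G R)).
  exact: RGenCInfty.measurableE.
move=> _ [_ [a ->] <-]; rewrite setTI.
(* A closed half-space is exhausted by boxes: coordinate [i] ranges over [[a, n]], the others over
   [[-n, n]]. *)
rewrite (_ : _ @^-1` _ = \bigcup_n
    box (\row_j if j == i then a else - n%:R) (const_mx n%:R)).
  apply: (@bigcup_measurable _ TG) => n _; apply: sub_sigma_algebra.
  by eexists; eexists.
apply/seteqP; split => x /=; rewrite in_itv/= andbT.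
  move=> ax; have [n hn] : exists n : nat, forall j, `|x ord0 j| <= n%:R.
    exists (Num.truncn (\sum_j `|x ord0 j|)).+1 => j.
    apply: le_trans (ltW (truncnS_gt _)).
    by rewrite (bigD1 j)//= lerDl sumr_ge0.
  exists n => // j; rewrite !mxE; have := hn j; rewrite ler_norml => /andP[h1 h2].
  by rewrite h2 andbT; case: eqP => [->|_].
by move=> [n _ /(_ i)]; rewrite !mxE eqxx => /andP[].
Qed.

Lemma boxI (a b a' b' : V) : box a b `&` box a' b' =
  box (\row_i Num.max (a ord0 i) (a' ord0 i)) (\row_i Num.min (b ord0 i) (b' ord0 i)).
Proof.
apply/seteqP; split => x /=.
  move=> [h h'] i; rewrite !mxE ge_max le_min.
  by have /andP[-> ->] := h i; have /andP[-> ->] := h' i.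
by move=> h; split => i; have := h i; rewrite !mxE ge_max le_min =>
  /andP[/andP[h1 h2] /andP[h3 h4]]; apply/andP; split.
Qed.

Variable mu : {measure set V -> \bar R}.
Hypothesis mu_leb : is_lebesgue mu.

Lemma lebesgue_box_lty (a b : V) : (mu (box a b) < +oo)%E.
Proof.
have [ab|/existsNP[i /negP]] := pselect (forall i, a ord0 i <= b ord0 i).
  by rewrite mu_leb// ltry.
rewrite -ltNge => ba; rewrite (_ : box a b = set0) ?measure0// -subset0 => x /(_ i).
by move=> /andP[/le_trans h /h]; rewrite leNgt ba.
Qed.

(* Reflection in x / 2 sends boxes to boxes of the same volume. *)
Lemma lebesgue_reflect x (A : set V) : measurable A ->
  mu ((fun y => x - y) @^-1` A) = mu A.
Proof.
move=> mA.
have mr : measurable_fun setT (fun y : V => x - y).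
  exact: measurableT_comp measurable_subV (pair1_measurable x).
pose r_mixin := isMeasurableFun.Build _ _ _ _ _ mr.
pose r : {mfun V >-> V} := HB.pack (fun y : V => x - y) r_mixin.
have refl_box (a b : V) : (fun y => x - y) @^-1` box a b = box (x - b) (x - a).
  apply/seteqP; split => y /= h i; have := h i; rewrite !mxE => /andP[h1 h2].
    by apply/andP; split; lra.
  by apply/andP; split; lra.
pose G := [set A : set V | exists a b : V, A = box a b].
pose g (n : nat) : set V := box (const_mx (- n%:R)) (const_mx n%:R).
apply/esym; apply: (@measure_unique _ R V G g measurable_rV_boxes _ _ _ mu
  (pushforward mu r)) => //.
- by move=> _ _ [a [b ->]] [a' [b' ->]]; rewrite boxI; eexists; eexists.
- by move=> n; eexists; eexists.
- rewrite -subTset => y _.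
  exists (Num.truncn (\sum_j `|y ord0 j|)).+1 => // j; rewrite !mxE -ler_norml.
  apply: le_trans (ltW (truncnS_gt _)).
  by rewrite (bigD1 j)//= lerDl sumr_ge0.
- move=> _ [a [b ->]]; rewrite /= /pushforward refl_box.
  (* [is_lebesgue] gives volumes for ordered corners only; otherwise both boxes are empty. *)
  have [ab|] := pselect (forall i, a ord0 i <= b ord0 i).
    rewrite !mu_leb//; last by move=> i; rewrite !mxE lerB.
    by congr EFin; apply: eq_bigr => i _; rewrite !mxE; ring.
  move=> /existsNP[i /negP]; rewrite -ltNge => ba.
  rewrite (_ : box a b = set0).
    rewrite (_ : box _ _ = set0) ?measure0// -subset0 => y /(_ i).
    by rewrite !mxE => /andP[h1 h2]; lra.
  by rewrite -subset0 => y /(_ i) /andP[h1 h2]; lra.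
- by move=> n; exact: lebesgue_box_lty.
Qed.

(** Applied to [J] and to its square, this bounds the rows of the kernel by the mass and the L^2
    norm of [J]. *)
Lemma ge0_integral_reflect x (F : V -> R) : measurable_fun setT F ->
  (forall z, 0 <= F z) -> (\int[mu]_y (F (x - y))%:E = \int[mu]_z (F z)%:E)%E.
Proof.
move=> mF F0; have mr : measurable_fun setT (fun y : V => x - y).
  exact: measurableT_comp measurable_subV (pair1_measurable x).
have := @ge0_integral_pushforward _ _ _ _ _ _ mr mu setT (EFin \o F) measurableT.
rewrite preimage_setT => <-; last 2 first.
- exact/measurable_EFinP.
- by move=> z _; rewrite lee_fin.
by apply: eq_measure_integral => A mA _; exact: lebesgue_reflect.
Qed.

End rV_measurable.

(** * Application to the Neumann problem *)

Section restriction.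
Context d (T : measurableType d) (R : realType).
Variables (mu : {measure set T -> \bar R}) (D : set T) (mD : measurable D).
Hypothesis muD : (mu D < +oo)%E.

Let nu : {finite_measure set T -> \bar R} := mfrestr mD muD.

(** The complement of [D] is null for the restricted measure, so [F] has to match [f] on [D] only;
    this lets a zero extension stand for a function given on [D]. *)
Lemma restr_integral (F f : T -> \bar R) : measurable_fun setT F ->
  (forall x, D x -> F x = f x) -> (\int[nu]_x F x = \int[mu]_(x in D) f x)%E.
Proof.
move=> mF Ff.
have -> : (\int[nu]_x F x = \int[nu]_x (F \_ D) x)%E.
  apply: ae_eq_integral => //.
    by apply/(measurable_restrictT _ mD).1; exact: measurable_funS mF.
  exists (~` D); split; first exact: measurableC.
    by rewrite /= /mfrestr /mrestr setICl measure0.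
  move=> x /= /not_implyP[_ h] Dx; apply: h.
  by rewrite patchE mem_set.
rewrite -integral_mkcond (@eq_measure_integral _ _ _ _ mu).
  by apply: eq_integral => x /[!inE]; exact: Ff.
by move=> A mA AD; rewrite /= /mfrestr /mrestr setIidl.
Qed.

Lemma restr_Rintegral (F f : T -> R) : measurable_fun setT F ->
  (forall x, D x -> F x = f x) -> \int[nu]_x F x = \int[mu]_(x in D) f x.
Proof.
move=> mF Ff; congr fine; apply: restr_integral; first exact/measurable_EFinP.
by move=> x /Ff ->.
Qed.

Lemma le_restr_integral (F : T -> R) : measurable_fun setT F ->
  (forall x, 0 <= F x) -> (\int[nu]_x (F x)%:E <= \int[mu]_x (F x)%:E)%E.
Proof.
move=> mF F0; have mF' := (measurable_EFinP _ _).2 mF.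
rewrite (@restr_integral _ (EFin \o F))//.
by apply: ge0_subset_integral => // x _; rewrite lee_fin.
Qed.

Lemma measurable_patch (f : T -> R) : measurable_fun D f -> measurable_fun setT (f \_ D).
Proof. by move=> mf; apply/(measurable_restrictT _ mD).1. Qed.

Lemma patch_in (f : T -> R) x : D x -> (f \_ D) x = f x.
Proof. by move=> Dx; rewrite patchE mem_set. Qed.

End restriction.

(** A step length [r] common to all points makes [S] relatively open, through the balls around [S],
    and relatively closed, through the complement of the balls around [A] minus [S]. *)
Lemma connected_chain (R : realType) (V : pseudoMetricType R) (A S : set V) (r : R) :
  connected A -> 0 < r -> (forall x : V, open (ball x r)) -> S `<=` A -> S !=set0 ->
  (forall x y, S x -> A y -> ball x r y -> S y) -> S = A.
Proof.
move=> cA r0 ob SA S0 step; apply: cA => //.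
- exists (\bigcup_(x in S) ball x r); first exact: bigcup_open.
  apply/seteqP; split => [x Sx|y [Ay [x Sx xy]]]; last exact: step xy.
  by split; [exact: SA|exists x => //; exact: ballxx].
- exists (~` \bigcup_(x in A `\` S) ball x r).
    by apply: open_closedC; exact: bigcup_open.
  apply/seteqP; split => [x Sx|y [Ay ny]].
    split; first exact: SA.
    by move=> [y [Ay nSy] yx]; apply: nSy; apply: (step x) => //; exact: ball_sym.
  by apply: contrapT => nSy; apply: ny; exists y => //; exact: ballxx.
Qed.

(** * Balls, boxes and the measure of open and bounded sets *)

Section geometry.
Context (R : realType) (N : nat).
Local Notation V := 'rV[R]_N.

Lemma rV_ballP (x y : V) r : 0 < r ->
  ball x r y <-> forall i, `|x ord0 i - y ord0 i| < r.
Proof.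
move=> r0; split => [[_ h] i|h]; first exact: h.
by split => // i j; rewrite (ord1 i); exact: h.
Qed.

Lemma measurable_rV_ball (x : V) r : 0 < r -> measurable (ball x r).
Proof.
move=> r0; rewrite (_ : ball x r = \bigcap_(i in [set: 'I_N])
    ((fun y : V => y ord0 i) @^-1` ball (x ord0 i) r)).
  apply: fin_bigcap_measurable => // i _; rewrite -[X in measurable X]setTI.
  by apply: measurable_coord => //; apply: open_measurable; exact: ball_open.
apply/seteqP; split => y; first by move=> /rV_ballP h i _; exact: h.
by move=> h; apply/rV_ballP => // i; exact: h.
Qed.

Lemma rV_ball_open (x : V) r : 0 < r -> open (ball x r).
Proof. by move=> r0; exact: ball_open. Qed.

(** The kernel is bounded below on Euclidean balls while [ball] is a cube. The factor [N.+1] in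
    place of the sharp square root of [N] keeps the inequality strict in every dimension. *)
Lemma enorm_lt (z : V) r : 0 < r -> (forall i, `|z ord0 i| < r) ->
  enorm z < N.+1%:R * r.
Proof.
move=> r0 zr; rewrite /enorm -[ltRHS]ger0_norm ?mulr_ge0 ?ltW// -sqrtr_sqr.
rewrite ltr_sqrt ?exprn_gt0 ?mulr_gt0//.
apply: (@le_lt_trans _ _ (\sum_(i < N) r ^+ 2)).
  apply: ler_sum => i _; rewrite -real_normK ?num_real//.
  by rewrite lerXn2r ?nnegrE ?(ltW r0) ?(ltW (zr i)).
rewrite sumr_const card_ord -[ltLHS]mulr_natl exprMn ltr_pM2r ?exprn_gt0//.
by rewrite -natrX ltr_nat -mulnn (leq_trans (ltnSn N))// leq_pmulr.
Qed.

Lemma open_box_subset (Om : set V) p : open Om -> Om p ->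
  exists e : R, 0 < e /\ forall a b : V,
    (forall i, p ord0 i - e <= a ord0 i /\ b ord0 i <= p ord0 i + e) ->
    box a b `<=` Om.
Proof.
move=> oOm Omp; have /nbhs_ballP[e /= e0 he] : nbhs p Om by exact: open_nbhs_nbhs.
(* Half the radius, since boxes are closed and balls open. *)
exists (e / 2); split; first exact: divr_gt0.
move=> a b hab x hx; apply: he; apply/rV_ballP => // i.
have [h1 h2] := hab i; have /andP[h3 h4] := hx i.
by rewrite ltr_norml; apply/andP; split; lra.
Qed.

Variable mu : {measure set V -> \bar R}.
Hypothesis mu_leb : is_lebesgue mu.

Lemma box_gt0 (a b : V) : (forall i, a ord0 i < b ord0 i) -> (0 < mu (box a b))%E.
Proof.
move=> ab; rewrite mu_leb => [|i]; last exact: ltW.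
by rewrite lte_fin prodr_gt0// => i _; rewrite subr_gt0.
Qed.

Lemma open_gt0 (W : set V) : open W -> measurable W -> W !=set0 -> (0 < mu W)%E.
Proof.
move=> oW mW [p Wp]; have [e [e0 he]] := open_box_subset oW Wp.
pose a : V := \row_i (p ord0 i - e); pose b : V := \row_i (p ord0 i + e).
apply: (@lt_le_trans _ _ (mu (box a b))).
  by apply: box_gt0 => i; rewrite !mxE; lra.
apply: le_measure; rewrite ?inE//; first exact: measurable_box.
by apply: he => i; rewrite !mxE.
Qed.

Lemma bounded_lebesgue_lty (Om : set V) : measurable Om -> bounded_set Om ->
  (mu Om < +oo)%E.
Proof.
move=> mOm [M [_ hM]].
pose b : V := const_mx (M + 1).
apply: le_lt_trans (lebesgue_box_lty mu_leb (- b) b).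
apply: le_measure; rewrite ?inE//; first exact: measurable_box.
move=> x Omx i; have := hM (M + 1) _ x Omx; rewrite ltrDl ltr01 => /(_ isT) h.
rewrite !mxE -ler_norml; apply: le_trans h.
rewrite [leRHS]/Num.norm /= mx_normrE; apply/bigmax_geP; right => /=.
by exists (ord0, i).
Qed.

End geometry.

(** * Positivity of [beta] and decay on [Om] *)

Section neumann.
Context (R : realType) (N : nat).
Local Notation V := 'rV[R]_N.
Hypothesis N_gt0 : (0 < N)%N.
Variable mu : {measure set V -> \bar R}.
Hypothesis mu_leb : is_lebesgue mu.
Variable Om : set V.
Hypotheses (oOm : open Om) (Om0 : Om !=set0) (bOm : bounded_set Om)
  (cOm : connected Om) (mOm : measurable Om).
Variables (J : V -> R) (d : R).
Hypothesis HJ : kernel_assumptions mu J d.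
Hypothesis J_L2 : (\int[mu]_z ((J z) ^+ 2)%:E < +oo)%E.

Let Om_lty : (mu Om < +oo)%E := bounded_lebesgue_lty mu_leb mOm bOm.
Let nu : {finite_measure set V -> \bar R} := mfrestr mOm Om_lty.
Let k (z : V * V) := J (z.1 - z.2).

Let mJ : measurable_fun setT J. Proof. by case: HJ. Qed.
Let J_ge0 z : 0 <= J z. Proof. by case: HJ. Qed.

Let mk : measurable_fun setT k.
Proof. by apply: (measurableT_comp mJ); exact: measurable_subV. Qed.

Let k_ge0 z : 0 <= k z. Proof. exact: J_ge0. Qed.

Let kC x y : k (x, y) = k (y, x).
Proof. by rewrite /k /= -(opprB y x); case: HJ. Qed.

Let mkx x : measurable_fun setT (fun y => k (x, y)).
Proof. exact: measurableT_comp mk (pair1_measurable x). Qed.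

Let k_le1 x : (\int[nu]_y (k (x, y))%:E <= 1)%E.
Proof.
apply: le_trans (@le_restr_integral _ _ _ _ _ mOm Om_lty (fun y => k (x, y)) (mkx x) _) _ => //.
by rewrite /k /= (ge0_integral_reflect mu_leb x mJ J_ge0); case: HJ => _ _ _ [->].
Qed.

Let k_sq x : (\int[nu]_y (k (x, y) ^+ 2)%:E < +oo)%E.
Proof.
apply: le_lt_trans (@le_restr_integral _ _ _ _ _ mOm Om_lty (fun y => k (x, y) ^+ 2) _ _) _.
- exact: measurable_funX.
- by move=> y; exact: sqr_ge0.
have := @ge0_integral_reflect _ _ _ mu_leb x (fun z => J z ^+ 2).
by rewrite /k /= => ->//; [exact: measurable_funX|move=> z; exact: sqr_ge0].
Qed.

Let D (u : V -> R) :=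
  integral nu setT (fun x : V => \int[nu]_y (k (x, y) * (u y - u x) ^+ 2)%:E)%E.

Let nu_gt0 (A : set V) : measurable A -> open A -> A `&` Om !=set0 -> 0 < fine (nu A).
Proof.
move=> mA oA A0; apply: fine_gt0; apply/andP; split; last first.
  by rewrite -ge0_fin_numE// fin_num_measure.
rewrite /= /mfrestr /mrestr; apply: (open_gt0 mu_leb) => //; first exact: openI.
exact: measurableI.
Qed.

Lemma neumann_poincare : exists K : R, 0 < K /\ forall u : V -> R, sqint nu u ->
  \int[nu]_x ((u x - average nu setT u) ^+ 2) <= K * fine (D u).
Proof.
have [_ _ _ [_ d0 _ Jd]] := HJ.
have [|c [c0 hc]] := Jd (d / 2); first by lra.
(* Two points of a ball of radius [r] differ by less than [2 r] in each coordinate, hence by less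
   than [N.+1 * (2 r) = d / 2] in Euclidean norm, where [J >= c]. *)
pose r := d / 2 / N.+1%:R / 2; have r0 : 0 < r by rewrite !divr_gt0.
have ck (p x y : V) : ball p r x -> ball p r y -> c <= k (x, y).
  move=> /rV_ballP-/(_ r0) px /rV_ballP-/(_ r0) py; apply: hc.
  have -> : d / 2 = N.+1%:R * (r * 2).
    by rewrite /r divfK// [RHS]mulrC divfK.
  apply: enorm_lt => [|i]; first by rewrite mulr_gt0.
  have := px i; have := py i; rewrite !mxE !ltr_norml => /andP[h1 h2] /andP[h3 h4].
  by apply/andP; split; lra.
have mB (p : V) : measurable (ball p r) by exact: measurable_rV_ball.
have oB (p : V) : open (ball p r) by exact: rV_ball_open.
have [p0 Omp0] := Om0.
pose m0 (u : V -> R) := average nu (ball p0 r) u.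
have base : linked nu k m0 (ball p0 r).
  have n0 : 0 < fine (nu (ball p0 r)).
    by apply: nu_gt0 => //; exists p0; split => //; exact: ballxx.
  exists (c * fine (nu (ball p0 r)))^-1; split.
    by rewrite invr_ge0 mulr_ge0 ?ltW.
  by move=> u hu; apply: (local_poincare mk k_ge0 kC k_le1) => // x y; exact: ck.
have chain : [set p : V | Om p /\ linked nu k m0 (ball p r)] = Om.
  apply: (connected_chain cOm r0 oB) => [p []//||x y [Omx lx] Omy xy].
    by exists p0.
  split; first exact: Omy.
  apply: (linked_overlap mk k_ge0 kC k_le1 (mB x) (mB y) _ c0 _ lx).
    (* The center [y] lies in both balls and in [Om], so the overlap is an open set meeting [Om] and
       has positive mass. *)
    apply: (nu_gt0 (measurableI _ _ (mB x) (mB y)) (openI (oB x) (oB y))).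
    by exists y; split; [split; [exact: xy|exact: ballxx]|exact: Omy].
  by move=> ? ?; exact: ck.
(* The constants found by chaining have no common bound over [Om]; a finite cover by balls centered
   in [Om] replaces them by a finite sum. *)
have cc : cover_compact (closure Om).
  rewrite -compact_cover; apply: bounded_closed_compact; last exact: closed_closure.
  have [M [Mr hM]] := bOm; exists (M + 1); split; first exact: num_real.
  move=> L ML p clp; have L0 : 0 < L - (M + 1) by rewrite subr_gt0.
  have [q [Omq]] := clp _ (nbhsx_ballx p _ L0).
  rewrite -ball_normE /= => pq.
  have qM : `|q| <= M + 1 by apply: hM => //; rewrite ltrDl.
  rewrite -(subrK q p) (le_trans (ler_normD _ _))//.
  by rewrite -(subrK (M + 1) L) lerD// ltW.
have [|F FOm cov] := cc _ Om (fun p : V => ball p r) (fun p _ => oB p).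
  move=> p clp; have [q [Omq pq]] := clp _ (nbhsx_ballx p r r0).
  by exists q => //; exact: ball_sym.
have lOm : linked nu k m0 (\big[setU/set0]_(p <- finmap.enum_fset F) ball p r).
  suff : linked nu k m0 (\big[setU/set0]_(p <- finmap.enum_fset F) ball p r) /\
     measurable (\big[setU/set0]_(p <- finmap.enum_fset F) ball p r) by case.
  rewrite big_seq; apply: (big_ind (fun A => linked nu k m0 A /\ measurable A)).
  - by split => //; apply: linked_null => //; rewrite measure0.
  - move=> A B [lA mA] [lB mB']; split; last exact: measurableU.
    exact: (linkedU mA mB' lA lB).
  - move=> p /FOm pF; have Omp : Om p by move: pF; rewrite inE.
    split; last exact: mB.
    by rewrite -chain in Omp; case: Omp => _ lp; exact: lp.
set U := \big[setU/set0]_(p <- finmap.enum_fset F) ball p r in lOm.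
have mU : measurable U by exact: bigsetU_measurable.
(* [U] covers [Om] but not the whole space; what is left is null and links trivially. *)
have nU : nu (~` U) = 0%E.
  rewrite /= /mfrestr /mrestr (_ : ~` U `&` Om = set0) ?measure0//.
  rewrite -subset0 => x [nUx Omx]; apply: nUx; rewrite /U.
  have [p pF px] := cov x (subset_closure Omx).
  by rewrite -bigcup_seq; exists p.
apply: (linked_poincare _ _ _ (m0 := m0)) => //.
  by apply: nu_gt0 => //; [exact: openT|rewrite setTI].
rewrite -(setUv U); apply: linkedU => //; first exact: measurableC.
by apply: linked_null => //; exact: measurableC.
Qed.

Lemma sqint_patch u : L2 mu Om u -> sqint nu (u \_ Om).
Proof.
move=> [mfu uoo]; have mU := measurable_patch mOm mfu; split => //.
rewrite (@restr_integral _ _ _ mu Om mOm Om_lty _ (fun x => (u x ^+ 2)%:E))//.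
  by apply/measurable_EFinP; exact: measurable_funX.
by move=> x Omx; rewrite patch_in.
Qed.

Lemma sqint_L2 u : sqint nu u -> L2 mu Om u.
Proof.
move=> [mfu uoo]; split; first exact: measurable_funS mfu.
rewrite -(@restr_integral _ _ _ mu Om mOm Om_lty (fun x => (u x ^+ 2)%:E))//.
by apply/measurable_EFinP; exact: measurable_funX.
Qed.

Lemma kernel_op_restr (u U : V -> R) x : measurable_fun setT U ->
  (forall y, Om y -> U y = u y) -> Om x ->
  \int[nu]_y (k (x, y) * (U y - U x)) = neumann_op mu Om J u x.
Proof.
move=> mU Uu Omx; apply: restr_Rintegral.
  by apply: measurable_funM => //; exact: measurable_funB.
by move=> y Omy; rewrite !Uu.
Qed.

Lemma dirichlet_restr (u U : V -> R) : measurable_fun setT U ->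
  (forall x, Om x -> U x = u x) -> D U = dirichlet mu Om J u.
Proof.
move=> mU Uu; have mf : measurable_fun setT (fun z : V * V => k z * (U z.2 - U z.1) ^+ 2).
  apply: measurable_funM => //; apply: measurable_funX.
  by apply: measurable_funB; exact: measurableT_comp.
apply: restr_integral => [|x Omx].
  apply: (measurable_fun_fubini_tonelli_F (EFin \o (fun z : V * V => k z * (U z.2 - U z.1) ^+ 2))).
    exact/measurable_EFinP.
  by move=> z; rewrite lee_fin mulr_ge0 ?sqr_ge0.
apply: restr_integral => [|y Omy]; last by rewrite !Uu.
by apply/measurable_EFinP; exact: measurableT_comp mf (pair1_measurable x).
Qed.

Lemma average_restr (u U : V -> R) : measurable_fun setT U ->
  (forall x, Om x -> U x = u x) -> average nu setT U = mean mu Om u.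
Proof.
move=> mU Uu; congr (_ * _); last exact: restr_Rintegral.
by rewrite /= /mfrestr /mrestr setTI.
Qed.

Lemma sqdist_restr (u U : V -> R) c : sqint nu U -> (forall x, Om x -> U x = u x) ->
  (\int[nu]_x ((U x - c) ^+ 2))%:E = (\int[mu]_(x in Om) ((u x - c) ^+ 2)%:E)%E.
Proof.
move=> hU Uu; have hUc := sqintB hU (sqint_cst nu c).
rewrite EFin_Rintegral//; last exact: sqint_integrable_sq hUc.
apply: restr_integral => [|x Omx]; last by rewrite Uu.
by apply/measurable_EFinP; apply: measurable_funX; exact: hUc.1.
Qed.

Lemma varianceE (u U : V -> R) : sqint nu U -> (forall x, Om x -> U x = u x) ->
  Defs.variance mu Om u = (\int[nu]_x ((U x - average nu setT U) ^+ 2))%:E.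
Proof.
by move=> hU Uu; rewrite (average_restr hU.1 Uu) (sqdist_restr _ hU Uu).
Qed.

Let nuT_gt0 : 0 < fine (nu setT).
Proof. by apply: nu_gt0 => //; [exact: openT|rewrite setTI]. Qed.

(** The functions excluded from the infimum are thus those whose quotient has denominator 0. Given
    [U = c] almost everywhere, [mean_minimizes] spares identifying [c] with the mean. *)
Lemma ae_const_variance (U : V -> R) : sqint nu U ->
  ae_const mu Om U <-> Defs.variance mu Om U = 0%E.
Proof.
move=> hU; have mU : measurable_fun Om U by exact: measurable_funS hU.1.
have mUc c : measurable_fun Om (fun x => ((U x - c) ^+ 2)%:E).
  by apply/measurable_EFinP; apply: measurable_funX; exact: measurable_funB.
split => [[c Uc]|V0].
  have int0 : (\int[mu]_(x in Om) ((U x - c) ^+ 2)%:E = 0)%E.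
    rewrite (ae_eq_integral (cst 0%E))//; first by rewrite integral0.
    by apply: filterS Uc => x Uc Omx; rewrite Uc// subrr expr0n.
  rewrite (varianceE hU (fun _ _ => erefl)); congr EFin; apply/eqP.
  rewrite eq_le Rintegral_sq_ge0 andbT.
  apply: le_trans (mean_minimizes c hU measurableT nuT_gt0) _.
  by rewrite -lee_fin (@sqdist_restr U)// int0.
exists (mean mu Om U); have /(ae_eq_integral_abs mu mOm (mUc _)) :
    (\int[mu]_(x in Om) `|((U x - mean mu Om U) ^+ 2)%:E| = 0)%E.
  by under eq_integral do rewrite gee0_abs ?lee_fin ?sqr_ge0//; exact: V0.
apply: filterS => x h Omx; have [/eqP] := h Omx.
by rewrite sqrf_eq0 subr_eq0 => /eqP.
Qed.

(** The [inf] of an empty set is 0, so a positive [beta] requires a competitor. The indicator of a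
    half-space through a point of [Om] takes the values 1 and 0 on two boxes of positive measure
    inside [Om]; [N > 0] supplies the coordinate. *)
Lemma ex_non_ae_const : exists u : V -> R, L2 mu Om u /\ ~ ae_const mu Om u.
Proof.
have [p Omp] := Om0; have [e [e0 he]] := open_box_subset oOm Omp.
pose i0 := Ordinal N_gt0.
pose W := [set x : V | x ord0 i0 < p ord0 i0].
have mW : measurable W.
  have -> : W = (fun x : V => x ord0 i0) @^-1` `]-oo, p ord0 i0[%classic.
    by apply/seteqP; split => x; rewrite /W /= in_itv.
  by rewrite -[X in measurable X]setTI; exact: measurable_coord.
exists (\1_W); split.
  apply: sqint_L2; split; first exact: measurable_indic.
  apply: le_lt_trans (sqint_cst nu 1).2; apply: ge0_le_integral => //.
  - by apply/measurable_EFinP; apply: measurable_funX; exact: measurable_indic.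
  - by apply/measurable_EFinP; apply: measurable_funX.
  - by move=> x _; rewrite lee_fin indicE; case: (x \in W); rewrite ?expr0n ?expr1n ?ler01.
move=> [c [Z [mZ Z0 hZ]]].
have Zbox (a b : V) v : (forall i, a ord0 i < b ord0 i) ->
    (forall i, p ord0 i - e <= a ord0 i /\ b ord0 i <= p ord0 i + e) ->
    (forall x, box a b x -> \1_W x = v) -> v = c.
  move=> ab abe W_v; apply: contrapT => vc.
  have : (mu (box a b) <= mu Z)%E.
    apply: le_measure; rewrite ?inE//; first exact: measurable_box.
    move=> x abx; apply: hZ => /(_ (he _ _ abe x abx)).
    by rewrite W_v.
  by rewrite Z0 leNgt box_gt0.
have c1 : 1 = c.
  apply: (Zbox (\row_i (p ord0 i - e)) (\row_i (p ord0 i - e / 2))) => [i|i|x /(_ i0)].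
  - by rewrite !mxE; lra.
  - by rewrite !mxE; lra.
  - by rewrite !mxE => /andP[_ h]; rewrite indicE mem_set//= /W /=; lra.
have c0 : 0 = c.
  apply: (Zbox (\row_i (p ord0 i + e / 2)) (\row_i (p ord0 i + e))) => [i|i|x /(_ i0)].
  - by rewrite !mxE; lra.
  - by rewrite !mxE; lra.
  - by rewrite !mxE => /andP[h _]; rewrite indicE memNset//= /W /=; lra.
by have := oner_eq0 R; rewrite c1 -c0 eqxx.
Qed.

Let ratio (u : V -> R) := fine (dirichlet mu Om J u) / fine (Defs.variance mu Om u).

Lemma ratio_lower : exists K : R, 0 < K /\ forall u, L2 mu Om u ->
  ~ ae_const mu Om u -> K^-1 <= ratio u.
Proof.
have [K [K0 hK]] := neumann_poincare; exists K; split => // u hu nc.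
pose U := u \_ Om; have hU : sqint nu U by exact: sqint_patch.
have Uu x : Om x -> U x = u x by exact: patch_in.
have nV : Defs.variance mu Om u != 0%E.
  apply/eqP => V0; apply: nc.
  have : ae_const mu Om U.
    apply/(ae_const_variance hU).
    by rewrite (varianceE hU (fun _ _ => erefl)) -(varianceE hU Uu).
  by move=> [c hc]; exists c; apply: filterS hc => x h Omx; rewrite -Uu// h.
have := hK U hU; rewrite (dirichlet_restr hU.1 Uu) /ratio.
move: nV; rewrite (varianceE hU Uu) /= => nV hle.
have V0 : 0 < \int[nu]_x (U x - average nu setT U) ^+ 2.
  by rewrite lt_def Rintegral_sq_ge0 andbT; apply: contra_neq nV => ->.
by rewrite ler_pdivlMr// mulrC ler_pdivrMr// mulrC.
Qed.

Lemma beta_gt0 : 0 < beta mu Om J.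
Proof.
have [K [K0 hK]] := ratio_lower; apply: (@lt_le_trans _ _ K^-1); first by rewrite invr_gt0.
apply: lb_le_inf; last by move=> _ [u [hu nc ->]]; exact: hK.
have [u [hu nc]] := ex_non_ae_const.
by exists (ratio u), u.
Qed.

Lemma beta_poincare (U : V -> R) : sqint nu U ->
  beta mu Om J * \int[nu]_x ((U x - average nu setT U) ^+ 2) <= fine (D U).
Proof.
move=> hU; have D0 : 0 <= fine (D U).
  apply: fine_ge0; apply: integral_ge0 => x _; apply: integral_ge0 => y _.
  by rewrite lee_fin mulr_ge0 ?sqr_ge0.
have [c|nc] := pselect (ae_const mu Om U).
  move/(ae_const_variance hU) : c; rewrite (varianceE hU (fun _ _ => erefl)) => -[->].
  by rewrite mulr0.
have V0 : 0 < \int[nu]_x (U x - average nu setT U) ^+ 2.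
  rewrite lt_def Rintegral_sq_ge0 andbT; apply/eqP => V0; apply: nc.
  by apply/(ae_const_variance hU); rewrite (varianceE hU (fun _ _ => erefl)) V0.
rewrite -ler_pdivlMr//.
have -> : fine (D U) / \int[nu]_x (U x - average nu setT U) ^+ 2 = ratio U.
  by rewrite /ratio (varianceE hU (fun _ _ => erefl)) -(dirichlet_restr hU.1 (fun _ _ => erefl)).
(* An [inf] is a lower bound only for a set bounded below, which [ratio_lower] guarantees. *)
have [K [_ hK]] := ratio_lower.
apply: ge_inf; last by exists U; split => //; exact: sqint_L2.
by exists K^-1 => _ [u [hu nc' ->]]; exact: hK.
Qed.

Lemma solution_decay (u0 : V -> R) (u : R -> V -> R) :
  L2 mu Om u0 -> solution mu Om J u0 u -> forall t, 0 <= t ->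
  (\int[mu]_(x in Om) ((u t x - mean mu Om u0) ^+ 2)%:E <=
   (expR (- (beta mu Om J * t)))%:E *
   \int[mu]_(x in Om) ((u0 x - mean mu Om u0) ^+ 2)%:E)%E.
Proof.
move=> hu0 [hu du u00] t t0.
pose U s := u s \_ Om; have hU s : 0 <= s -> sqint nu (U s).
  by move=> s0; apply: sqint_patch; exact: hu.
have Uu s x : Om x -> U s x = u s x by exact: patch_in.
have dU s : 0 <= s ->
    (\int[nu]_x (((U (s + h) x - U s x) / h -
       \int[nu]_y (k (x, y) * (U s y - U s x))) ^+ 2)%:E)%E
    @[h --> half_line_increments s] --> 0%E.
  move=> s0; apply: cvg_trans (du s s0); apply: near_eq_cvg.
  apply: filterS (increments_near s) => h -[_ sh0].
  apply/esym; apply: restr_integral => [|x Omx]; last first.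
    by rewrite (kernel_op_restr (u := u s) (hU s s0).1 (Uu s))// !Uu.
  apply/measurable_EFinP; apply: measurable_funX; apply: measurable_funB.
    apply: measurable_funM => //; apply: measurable_funB; last exact: (hU s s0).1.
    exact: (hU _ sh0).1.
  exact: (measurable_kernel_op mk k_ge0 kC k_le1 (hU s s0)).
(* [u 0] and [u0] agree almost everywhere only, so the mean here and the initial variance below are
   transferred through integrals. *)
have m0 : average nu setT (U 0) = mean mu Om u0.
  rewrite (average_restr (hU 0 (lexx 0)).1 (Uu 0)); congr (_ * fine _).
  apply: ae_eq_integral => //; try by apply/measurable_EFinP; have [] := hu 0 (lexx 0).
    by apply/measurable_EFinP; have [] := hu0.
  by apply: filterS u00 => x h Omx; rewrite h.
have := variance_decay mk k_ge0 kC k_le1 k_sq beta_poincare hU dU t0.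
rewrite -/(average nu setT (U 0)) m0 -lee_fin EFinM.
rewrite (sqdist_restr _ (hU t t0) (Uu t)) (sqdist_restr _ (hU 0 (lexx 0)) (Uu 0)).
congr (_ <= _ * _)%E; apply: ae_eq_integral => //.
- apply/measurable_EFinP; apply: measurable_funX; apply: measurable_funB => //.
  by have [] := hu 0 (lexx 0).
- apply/measurable_EFinP; apply: measurable_funX; apply: measurable_funB => //.
  by have [] := hu0.
- by apply: filterS u00 => x h Omx; rewrite h.
Qed.

End neumann.

Unset Implicit Arguments.

Theorem theorem3p5 (R : realType) (N : nat) (N_gt0 : (0 < N)%N)
  (mu : {measure set 'rV[R]_N -> \bar R}) (mu_leb : is_lebesgue mu)
  (Om : set 'rV[R]_N) (Om_dom : smooth_domain Om) (mOm : measurable Om)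
  (J : 'rV[R]_N -> R) (d : R) (HJ : kernel_assumptions mu J d)
  (J_L2 : (\int[mu]_z ((J z) ^+ 2)%:E < +oo)%E) :
  0 < beta mu Om J /\
  forall (u0 : 'rV[R]_N -> R) (u : R -> 'rV[R]_N -> R),
    L2 mu Om u0 -> solution mu Om J u0 u ->
    forall t : R, 0 <= t ->
      (\int[mu]_(x in Om) ((u t x - mean mu Om u0) ^+ 2)%:E <=
       (expR (- (beta mu Om J * t)))%:E *
       \int[mu]_(x in Om) ((u0 x - mean mu Om u0) ^+ 2)%:E)%E.
Proof.
have [oOm [Om0 [bOm [cOm _]]]] := Om_dom; split.
  exact: (beta_gt0 N_gt0 mu_leb oOm Om0 bOm cOm mOm HJ).
move=> u0 u hu0 hu t t0.
exact: (solution_decay mu_leb oOm Om0 bOm cOm mOm HJ J_L2 hu0 hu t0).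
Qed.
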